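(* Let $M$ be an $n$-dimensional manifold endowed with a commutative associative product on vector fields given by a $(1,2)$-tensor field $c$, and with a torsionless connection $\nabla$ satisfying $\nabla_l c^i_{jk}=\nabla_jc^i_{lk}$. Assume that there exist canonical coordinates $(r^1,\dots,r^n)$, and let $\Gamma^i_{jk}$ be the Christoffel symbols of $\nabla$ in these coordinates. Then the condition $$R^k_{lmi}c^n_{pk}+R^k_{lip}c^n_{mk}+R^k_{lpm}c^n_{ik}=0\qquad\text{for all indices } l,m,i,p,n$$ (sum over $k$; here the index $n$ ranges over $1,\dots,\dim M$) is equivalent to the conditions $$\partial_i \Gamma^k_{mk}-\partial_m\Gamma^k_{ik}=0,$$ $$\partial_i\Gamma^k_{km}-\Gamma^k_{km}\Gamma^m_{im}+\Gamma^k_{ik}\Gamma^k_{km}-\Gamma^k_{ik}\Gamma^i_{im}=0$$ (no sums) for all pairwise distinct indices $k,i,m$.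
   Context: The product is $(X\circ Y)^i=c^i_{jk}X^jY^k$. Canonical coordinates are local coordinates in which $c^k_{ij}=\delta^k_i\delta^k_j$; the statement is local, on the domain of such coordinates, and $\partial_i=\partial/\partial r^i$. The Christoffel symbols are defined by $\nabla_j X^i=\partial_jX^i+\Gamma^i_{jk}X^k$. The curvature $R(X,Y)(Z)=\nabla_X\nabla_YZ-\nabla_Y\nabla_XZ-\nabla_{[X,Y]}Z$ of $\nabla$ has components $R(\partial_m,\partial_i)(\partial_l)=R^k_{lmi}\partial_k$; the first condition is the coordinate form of $Z\circ R(W,Y)(X)+W\circ R(Y,Z)(X)+Y\circ R(Z,W)(X)=0$ for all vector fields $X,Y,W,Z$. *)

(* Defs.v *)
(* A coordinate domain of an n-dimensional real manifold is an open set
   U of 'rV[R]_n, and the coordinates r^1, ..., r^n are the entries of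
   x : 'rV[R]_n.  Fields are total functions on 'rV[R]_n of which only the
   restriction to the open set U is meaningful. *)
From HB Require Import structures.
From mathcomp Require Import all_boot all_order all_algebra.
From mathcomp Require Import all_classical all_reals all_analysis.

Set Implicit Arguments.
Unset Strict Implicit.
Unset Printing Implicit Defensive.
Import Order.TTheory GRing.Theory Num.Theory.
Import numFieldNormedType.Exports.

Local Open Scope classical_set_scope.
Local Open Scope ring_scope.

Section LocalGeometry.
Context {R : realType} {n : nat}.

Definition scalar_field := 'rV[R]_n -> R.
Definition vector_field := 'rV[R]_n -> 'rV[R]_n.

(* Components with one upper and two lower indices, upper index first:
   [T i j k] is T^i_{jk}.  Used for (1,2)-tensor fields and for Christoffel
   symbols. *)
Definition field12 := 'I_n -> 'I_n -> 'I_n -> scalar_field.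

Implicit Types (U : set 'rV[R]_n) (f : scalar_field) (X Y Z : vector_field).
Implicit Types (c Gamma : field12) (i j k l m p : 'I_n).

Definition partial i f : scalar_field := fun x => 'D_(delta_mx 0 i) f x.

Definition iter_partial (s : seq 'I_n) f : scalar_field := foldr partial f s.

(* Class C^oo on U: iterated partial derivatives of every order exist and are
   continuous on U (s = [::] is f itself). *)
Definition smooth_on U f : Prop :=
  forall (s : seq 'I_n) x, U x ->
    {for x, continuous (iter_partial s f)} /\
    forall i, derivable (iter_partial s f) x (delta_mx 0 i).

Definition component X i : scalar_field := fun x => X x 0 i.

Definition smooth_vf U X : Prop := forall i, smooth_on U (component X i).

Definition smooth_field12 U (T : field12) : Prop :=
  forall i j k, smooth_on U (T i j k).

Definition coord_vf i : vector_field := fun=> delta_mx 0 i.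

Definition lie_bracket X Y : vector_field := fun x =>
  \row_i \sum_j (X x 0 j * partial j (component Y i) x
                 - Y x 0 j * partial j (component X i) x).

Definition vf_prod c X Y : vector_field := fun x =>
  \row_i \sum_j \sum_k c i j k x * X x 0 j * Y x 0 k.

Definition prod_commutative U c : Prop :=
  forall X Y, smooth_vf U X -> smooth_vf U Y ->
  forall x, U x -> vf_prod c X Y x = vf_prod c Y X x.

Definition prod_associative U c : Prop :=
  forall X Y Z, smooth_vf U X -> smooth_vf U Y -> smooth_vf U Z ->
  forall x, U x ->
    vf_prod c (vf_prod c X Y) Z x = vf_prod c X (vf_prod c Y Z) x.

Definition canonical_coordinates U c : Prop :=
  forall k i j x, U x -> c k i j x = (k == i)%:R * (k == j)%:R.

(* [nabla Gamma X Y] is nabla_X Y for the connection whose Christoffel symbols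
   in the coordinates r are Gamma^i_{jk}; j is the differentiation index:
   (nabla_X Y)^i = X^j (d_j Y^i + Gamma^i_{jk} Y^k). *)
Definition nabla Gamma X Y : vector_field := fun x =>
  \row_i \sum_j X x 0 j *
    (partial j (component Y i) x + \sum_k Gamma i j k x * Y x 0 k).

Definition torsionless U Gamma : Prop :=
  forall X Y, smooth_vf U X -> smooth_vf U Y -> forall x, U x ->
    nabla Gamma X Y x - nabla Gamma Y X x - lie_bracket X Y x = 0.

(* [nabla12 Gamma c l i j k] is nabla_l c^i_{jk}. *)
Definition nabla12 Gamma c l i j k : scalar_field := fun x =>
  partial l (c i j k) x
  + \sum_p Gamma i l p x * c p j k x
  - \sum_p Gamma p l j x * c i p k x
  - \sum_p Gamma p l k x * c i j p x.

Definition curvature Gamma X Y Z : vector_field := fun x =>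
  nabla Gamma X (nabla Gamma Y Z) x - nabla Gamma Y (nabla Gamma X Z) x
  - nabla Gamma (lie_bracket X Y) Z x.

(* [curv_comp Gamma k l m i] is R^k_{lmi}, where
   R(d_m, d_i)(d_l) = R^k_{lmi} d_k. *)
Definition curv_comp Gamma k l m i : scalar_field :=
  component (curvature Gamma (coord_vf m) (coord_vf i) (coord_vf l)) k.

End LocalGeometry.

Arguments field12 : clear implicits.
Arguments scalar_field : clear implicits.
Arguments vector_field : clear implicits.

(* Main.v *)
Require Import Defs.
From HB Require Import structures.
From mathcomp Require Import all_boot all_order all_algebra.
From mathcomp Require Import all_classical all_reals all_analysis.
From mathcomp Require Import ring lra.

(** In canonical coordinates c^q_{pk} = delta^q_p delta^q_k, so the cyclic
    identity with indices l, m, i, p, q reads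
      R^q_{lmi} delta^q_p + R^q_{lip} delta^q_m + R^q_{lpm} delta^q_i = 0.
    If two of m, i, p coincide, the left-hand side vanishes by the antisymmetry
    of R in its last two indices; if they are distinct, only q in {m, i, p}
    gives information.  The identity therefore says exactly that
    R^k_{lmi} = 0 for k, m, i pairwise distinct and l arbitrary
    ([cyclic_curv_iff]).

    The symmetry of nabla c, together with the symmetry of Gamma in its lower
    indices, leaves few Christoffel symbols: Gamma^i_{jk} = 0 when i, j, k are
    pairwise distinct ([Gamma_distinct]), and Gamma^i_{jj} = - Gamma^i_{ij}
    when i != j ([Gamma_diag]).  Hence only two terms survive in each quadratic
    sum of the curvature ([sum_GammaE]).  For k, m, i pairwise distinct, what
    remains depends on the position of l:
    - l = k: the quadratic terms cancel, and R^k_{kmi} is, up to sign, the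
      left-hand side of the first condition ([curv_repeat_upper]);
    - l = m: R^k_{mmi} is the left-hand side of the second condition
      ([curv_repeat_lower]);
    - l = i: minus the previous case with m and i exchanged;
    - l outside {k, m, i}: every term contains a symbol with three distinct
      indices, so R^k_{lmi} = 0 ([curv_all_distinct]). *)

Set Implicit Arguments.
Unset Strict Implicit.
Unset Printing Implicit Defensive.
Import Order.TTheory GRing.Theory Num.Theory.
Import numFieldNormedType.Exports.
Local Open Scope classical_set_scope.
Local Open Scope ring_scope.

(** * Coordinate fields and the components of the curvature *)

Lemma partial_cst (R : realType) n (i : 'I_n) (a : R) x :
  partial i (fun=> a) x = 0.
Proof. exact: derive_cst. Qed.

(** The tensor fields satisfy their identities on U only; openness is what lets
    such an identity be differentiated at a point of U. *)
Lemma eq_partial (R : realType) n (U : set 'rV[R]_n) (i : 'I_n) f g x :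
  open U -> U x -> {in U, f =1 g} -> partial i f x = partial i g x.
Proof.
move=> oU Ux fg; apply: near_eq_derive.
near=> y; apply/fg; rewrite inE; near: y.
exact: open_nbhs_nbhs.
Unshelve. all: by end_near. Qed.

Lemma smooth_coord_vf (R : realType) n (U : set 'rV[R]_n) i :
  smooth_vf U (coord_vf i).
Proof.
move=> j s x _.
have [a ->] : exists a : R,
    iter_partial s (component (coord_vf i) j) = (fun=> a).
  elim: s => [|l s [a IH]]; first by exists (delta_mx (0 : 'I_1) i 0 j).
  by exists 0; apply/funext => y; rewrite /= IH partial_cst.
by split=> [|l]; [exact: cst_continuous | exact: derivable_cst].
Qed.

Lemma nabla_coord_vf (R : realType) n (Gamma : field12 R n) i Y x :
  nabla Gamma (coord_vf i) Y x =
  \row_k (partial i (component Y k) x + \sum_p Gamma k i p x * Y x 0 p).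
Proof.
apply/rowP => k; rewrite !mxE (bigD1 i) //= mxE !eqxx mul1r.
rewrite [X in _ + X = _]big1 ?addr0 // => j ji.
by rewrite mxE (negPf ji) andbF mul0r.
Qed.

Lemma nabla_coord_coord (R : realType) n (Gamma : field12 R n) i l x :
  nabla Gamma (coord_vf i) (coord_vf l) x = \row_k Gamma k i l x.
Proof.
rewrite nabla_coord_vf; apply/rowP => k; rewrite !mxE.
rewrite partial_cst add0r (bigD1 l) //= mxE !eqxx mulr1 big1 ?addr0 //.
by move=> j jl; rewrite mxE (negPf jl) andbF mulr0.
Qed.

Lemma lie_bracket_coord (R : realType) n i l :
  lie_bracket (coord_vf i) (coord_vf l) = (fun=> 0 : 'rV[R]_n).
Proof.
apply/funext => x; apply/rowP => k; rewrite !mxE big1 // => j _.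
by rewrite !partial_cst !mulr0 subrr.
Qed.

(** The coordinate fields commute and have constant components, so only the
    derivatives of Gamma and the products of its components remain. *)
Lemma curv_compE (R : realType) n (Gamma : field12 R n) k l m i x :
  curv_comp Gamma k l m i x =
  partial m (Gamma k i l) x - partial i (Gamma k m l) x
  + \sum_p Gamma k m p x * Gamma p i l x
  - \sum_p Gamma k i p x * Gamma p m l x.
Proof.
have nablaE j h : nabla Gamma (coord_vf j) (coord_vf h)
    = (fun y => \row_k Gamma k j h y).
  by apply/funext => y; rewrite nabla_coord_coord.
have compE j h : component (fun y => \row_k Gamma k j h y) k = Gamma k j h.
  by apply/funext => y; rewrite /component mxE.
rewrite /curv_comp /component /curvature lie_bracket_coord !nablaE.
rewrite !nabla_coord_vf !mxE !compE.
rewrite [X in _ - _ - X]big1 => [|j _]; last by rewrite mxE mul0r.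
under eq_bigr do rewrite mxE.
under [X in _ - (_ + X)]eq_bigr do rewrite mxE.
by ring.
Qed.

Lemma curv_compN (R : realType) n (Gamma : field12 R n) k l m i x :
  curv_comp Gamma k l m i x = - curv_comp Gamma k l i m x.
Proof. by rewrite !curv_compE; ring. Qed.

(** Coordinate fields commute, so evaluating the torsion on them leaves the
    antisymmetric part of Gamma. *)
Lemma torsionless_sym (R : realType) n (U : set 'rV[R]_n) (Gamma : field12 R n) :
  torsionless U Gamma ->
  forall i j k x, U x -> Gamma i j k x = Gamma i k j x.
Proof.
move=> tG i j k x Ux.
have := tG _ _ (smooth_coord_vf j) (smooth_coord_vf k) x Ux.
rewrite lie_bracket_coord !nabla_coord_coord subr0 => /rowP/(_ i).
by rewrite !mxE => /subr0_eq.
Qed.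

(** The components of c are constant on U, so the derivative term vanishes and
    each contraction with c selects a single Christoffel symbol. *)
Lemma nabla12_canonical (R : realType) n (U : set 'rV[R]_n)
    (c Gamma : field12 R n) l i j k x :
  open U -> canonical_coordinates U c -> U x ->
  nabla12 Gamma c l i j k x =
  Gamma i l j x * (j == k)%:R - Gamma i l j x * (i == k)%:R
  - Gamma i l k x * (i == j)%:R.
Proof.
move=> oU cc Ux; rewrite /nabla12.
rewrite (eq_partial (g := fun=> (i == j)%:R * (i == k)%:R) _ oU Ux); last first.
  by move=> y; rewrite inE => Uy; rewrite cc.
rewrite partial_cst add0r.
rewrite (bigD1 j) //= [X in _ + X - _ - _]big1 ?addr0; last first.
  by move=> p pj; rewrite cc // (negPf pj) mul0r mulr0.
rewrite (bigD1 i) //= [X in _ - (_ + X) - _]big1 ?addr0; last first.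
  by move=> p pi; rewrite cc // eq_sym (negPf pi) mul0r mulr0.
rewrite (bigD1 i) //= [X in _ - _ - (_ + X)]big1 ?addr0; last first.
  by move=> p pi; rewrite cc // [i == p]eq_sym (negPf pi) !mulr0.
by rewrite !cc // !eqxx !mul1r mulr1.
Qed.

(** * Reduction of the cyclic identity *)

Section CanonicalCoordinates.
Context {R : realType} {n : nat} (U : set 'rV[R]_n) (c Gamma : field12 R n).
Hypothesis openU : open U.
Hypothesis canonical_c : canonical_coordinates U c.

Lemma cyclic_curv_sumE l m i p q x : U x ->
  \sum_(k < n) (curv_comp Gamma k l m i x * c q p k x
                + curv_comp Gamma k l i p x * c q m k x
                + curv_comp Gamma k l p m x * c q i k x)
  = curv_comp Gamma q l m i x * (q == p)%:R
    + curv_comp Gamma q l i p x * (q == m)%:R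
    + curv_comp Gamma q l p m x * (q == i)%:R.
Proof.
move=> Ux; have cE a k : c q a k x = (q == a)%:R * (q == k)%:R.
  exact: canonical_c.
(* Abstracting the curvature keeps it from being unfolded by unification. *)
move: (curv_comp Gamma) => C; rewrite (bigD1 q) //= big1 => [|k kq].
  by rewrite !cE !eqxx !mulr1 addr0.
by rewrite !cE [q == k]eq_sym (negPf kq) !mulr0 !addr0.
Qed.

(** Taking q = p distinct from m and i isolates one curvature component.
    Conversely, the terms of the sum that are not covered by the vanishing
    either have equal last indices or cancel in pairs by antisymmetry. *)
Lemma cyclic_curv_iff :
  (forall l m i p q x, U x ->
     \sum_(k < n) (curv_comp Gamma k l m i x * c q p k x
                   + curv_comp Gamma k l i p x * c q m k x
                   + curv_comp Gamma k l p m x * c q i k x) = 0)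
  <-> (forall k i m, k != i -> k != m -> i != m ->
       forall l x, U x -> curv_comp Gamma k l m i x = 0).
Proof.
split=> [H k i m ki km im l x Ux | H l m i p q x Ux].
  have := H l m i k k x Ux; rewrite cyclic_curv_sumE //.
  move: (curv_comp Gamma) => C.
  by rewrite eqxx (negPf ki) (negPf km) !mulr0 !addr0 mulr1.
rewrite cyclic_curv_sumE //.
have Rd a : curv_comp Gamma q l a a x = 0 by rewrite curv_compE; ring.
have R0 a b : q != a -> q != b -> curv_comp Gamma q l a b x = 0.
  move=> qa qb; have [->|ab] := eqVneq a b; first exact: Rd.
  by apply: H => //; rewrite eq_sym.
have RN a b := curv_compN Gamma q l a b x.
move: (curv_comp Gamma q l) Rd R0 RN => C Rd R0 RN.
(* With q = p = m, say, the two surviving terms are R^q_{lqi} and R^q_{liq},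
   which are opposite. *)
have [<-|qp] := eqVneq q p; have [<-|qm] := eqVneq q m;
  have [<-|qi] := eqVneq q i;
  rewrite ?mulr1 ?mulr0 ?addr0 ?add0r ?Rd ?addr0 ?add0r //;
  by [exact: R0 | rewrite RN addNr].
Qed.

(** * Christoffel symbols in canonical coordinates *)

Hypothesis smooth_Gamma : smooth_field12 U Gamma.
Hypothesis torsionless_Gamma : torsionless U Gamma.
Hypothesis nabla_c_sym : forall l i j k x, U x ->
  nabla12 Gamma c l i j k x = nabla12 Gamma c j i l k x.

Let Gamma_sym := torsionless_sym torsionless_Gamma.

(** The symmetry nabla_j c^i_{kk} = nabla_k c^i_{jk}, in which only the term
    Gamma^i_{jk} c^k_{kk} survives. *)
Lemma Gamma_distinct i j k x : U x -> i != j -> i != k -> j != k ->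
  Gamma i j k x = 0.
Proof.
move=> Ux ij ik jk; have := nabla_c_sym j i k k Ux.
rewrite !(nabla12_canonical _ _ _ _ _ openU canonical_c Ux).
by rewrite !eqxx (negPf ij) (negPf ik) (negPf jk) !mulr0 !subr0 mulr1.
Qed.

(** The symmetry nabla_i c^i_{jj} = nabla_j c^i_{ij}: the left side reduces to
    Gamma^i_{ij} and the right side to - Gamma^i_{jj}. *)
Lemma Gamma_diag i j x : U x -> i != j -> Gamma i j j x = - Gamma i i j x.
Proof.
move=> Ux ij; have := nabla_c_sym i i j j Ux.
rewrite !(nabla12_canonical _ _ _ _ _ openU canonical_c Ux).
by rewrite !eqxx (negPf ij) !mulr0 !mulr1 !subr0 sub0r => ->; rewrite opprK.
Qed.

(** Only p = k and p = m contribute, and their coefficients are opposite by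
    [Gamma_diag]. *)
Lemma sum_GammaE k m (F : 'I_n -> R) x : U x -> k != m ->
  \sum_p Gamma k m p x * F p = Gamma k k m x * (F k - F m).
Proof.
move=> Ux km; rewrite (bigD1 k) //= (bigD1 m) 1?eq_sym //= big1 => [|p].
  by rewrite Gamma_diag // (Gamma_sym k m k Ux); ring.
by case/andP=> pk pm; rewrite Gamma_distinct ?mul0r // eq_sym.
Qed.

(** * Curvature components with distinct upper and last two lower indices *)

Lemma curv_distinctE k l m i x : U x -> k != m -> k != i ->
  curv_comp Gamma k l m i x =
  partial m (Gamma k i l) x - partial i (Gamma k m l) x
  + Gamma k k m x * (Gamma k i l x - Gamma m i l x)
  - Gamma k k i x * (Gamma k m l x - Gamma i m l x).
Proof. by move=> Ux km ki; rewrite curv_compE !sum_GammaE. Qed.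

Lemma partial_Gamma_distinct h i j k x : U x -> i != j -> i != k -> j != k ->
  partial h (Gamma i j k) x = 0.
Proof.
move=> Ux ij ik jk; rewrite -(partial_cst h 0 x).
by apply: eq_partial openU Ux _ => y; rewrite inE => Uy; exact: Gamma_distinct.
Qed.

(** Smoothness of Gamma enters here, through the derivability that the rule for
    the derivative of an opposite requires. *)
Lemma partial_Gamma_diag h i j x : U x -> i != j ->
  partial h (Gamma i j j) x = - partial h (Gamma i i j) x.
Proof.
move=> Ux ij; rewrite (eq_partial (g := - Gamma i i j) _ openU Ux).
  by rewrite /partial deriveN //; have [] := smooth_Gamma i i j [::] Ux.
by move=> y; rewrite inE => Uy; exact: Gamma_diag.
Qed.

(** Both quadratic terms reduce to Gamma^k_{km} Gamma^k_{ki}, with opposite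
    signs. *)
Lemma curv_repeat_upper k m i x : U x -> k != i -> k != m -> i != m ->
  curv_comp Gamma k k m i x =
  partial m (Gamma k i k) x - partial i (Gamma k m k) x.
Proof.
move=> Ux ki km im; rewrite curv_distinctE //.
rewrite (@Gamma_distinct m i k) ?(@Gamma_distinct i m k) //; try by rewrite eq_sym.
by rewrite (Gamma_sym k i k Ux) (Gamma_sym k m k Ux); ring.
Qed.

(** The symbols Gamma^k_{mm} and Gamma^i_{mm} that arise are turned into
    - Gamma^k_{km} and - Gamma^i_{im}, which accounts for the signs of the
    condition. *)
Lemma curv_repeat_lower k m i x : U x -> k != i -> k != m -> i != m ->
  curv_comp Gamma k m m i x =
  partial i (Gamma k k m) x - Gamma k k m x * Gamma m i m x
  + Gamma k i k x * Gamma k k m x - Gamma k i k x * Gamma i i m x.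
Proof.
move=> Ux ki km im; rewrite curv_distinctE //.
rewrite partial_Gamma_distinct // partial_Gamma_diag //.
rewrite (@Gamma_distinct k i m) // (@Gamma_diag k m) // (@Gamma_diag i m) //.
by rewrite (Gamma_sym k i k Ux); ring.
Qed.

Lemma curv_all_distinct k l m i x : U x -> k != i -> k != m -> i != m ->
  l != k -> l != m -> l != i -> curv_comp Gamma k l m i x = 0.
Proof.
move=> Ux ki km im lk lm li; rewrite curv_distinctE //.
rewrite !partial_Gamma_distinct //; try by rewrite eq_sym.
rewrite (@Gamma_distinct k i l) ?(@Gamma_distinct m i l) //; try by rewrite eq_sym.
rewrite (@Gamma_distinct k m l) ?(@Gamma_distinct i m l) //; try by rewrite eq_sym.
by ring.
Qed.

End CanonicalCoordinates.

Theorem proposition21 (R : realType) (n : nat) (U : set 'rV[R]_n)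
    (c Gamma : field12 R n)
    (openU : open U)
    (smooth_c : smooth_field12 U c)
    (smooth_Gamma : smooth_field12 U Gamma)
    (comm_c : prod_commutative U c)
    (assoc_c : prod_associative U c)
    (torsionless_Gamma : torsionless U Gamma)
    (nabla_c_sym : forall (l i j k : 'I_n) (x : 'rV[R]_n), U x ->
       nabla12 Gamma c l i j k x = nabla12 Gamma c j i l k x)
    (canonical_c : canonical_coordinates U c) :
  (forall (l m i p q : 'I_n) (x : 'rV[R]_n), U x ->
     \sum_(k < n) (curv_comp Gamma k l m i x * c q p k x
                   + curv_comp Gamma k l i p x * c q m k x
                   + curv_comp Gamma k l p m x * c q i k x) = 0)
  <->
  (forall k i m : 'I_n, k != i -> k != m -> i != m ->
   forall x : 'rV[R]_n, U x ->
     partial i (Gamma k m k) x - partial m (Gamma k i k) x = 0 /\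
     partial i (Gamma k k m) x - Gamma k k m x * Gamma m i m x
       + Gamma k i k x * Gamma k k m x - Gamma k i k x * Gamma i i m x = 0).
Proof.
have upper := curv_repeat_upper openU canonical_c torsionless_Gamma nabla_c_sym.
have lower :=
  curv_repeat_lower openU canonical_c smooth_Gamma torsionless_Gamma nabla_c_sym.
rewrite (cyclic_curv_iff Gamma canonical_c).
split=> H k i m ki km im.
  move=> x Ux; rewrite -lower // (H k i m) //; split=> //.
  by rewrite -opprB -upper // (H k i m) // oppr0.
move=> l x Ux; have [Hk Hm] := H k i m ki km im x Ux.
have [->|lk] := eqVneq l k; first by rewrite upper // -opprB Hk oppr0.
have [->|lm] := eqVneq l m; first by rewrite lower.
have [->|li] := eqVneq l i.
  rewrite curv_compN lower // 1?eq_sym //.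
  by rewrite (H k m i km ki _ x Ux).2 ?oppr0 // eq_sym.
exact: (curv_all_distinct openU canonical_c).
Qed.
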